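(* Let $R$ be a commutative ring with identity. The following are equivalent: (i) $QPrim(R)$ is disconnected. (ii) $R\cong R_1\times R_2$ where $R_1$ and $R_2$ are nonzero rings. (iii) $R$ contains a nontrivial idempotent (an idempotent $e$ with $e\neq 0$ and $e\neq 1$).
   Context: All rings are commutative with identity. An ideal $I$ of $R$ is quasi-primary if its radical $\sqrt{I}$ is a prime ideal; $QPrim(R)$ denotes the set of all quasi-primary ideals of $R$. It carries the Zariski topology, whose closed sets are the sets $V_q(I)=\{Q\in QPrim(R): I\subseteq \sqrt{Q}\}$ for ideals $I$ of $R$. *)

(* Defs.v *)
From HB Require Import structures.
From mathcomp Require Import all_boot all_algebra.
From mathcomp Require Import all_classical topology.

Set Implicit Arguments.
Unset Strict Implicit.
Unset Printing Implicit Defensive.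

Import GRing.Theory.
Local Open Scope classical_set_scope.
Local Open Scope ring_scope.

Section Ideals.
Variable R : comPzRingType.
Implicit Types (I J P Q : set R).

(* [idealr] and [prime_idealr] of ring_quotient require a nonzero ring and a
   proper ideal; here the zero ring and the unit ideal must be allowed. *)
Definition is_ideal I : Prop :=
  [/\ I 0, forall x y, I x -> I y -> I (x + y) & forall a x, I x -> I (a * x)].

Definition prime_ideal P : Prop :=
  [/\ is_ideal P, ~ P 1 & forall x y, P (x * y) -> P x \/ P y].

Definition radical I : set R := [set x | exists n : nat, I (x ^+ n.+1)].

Definition quasi_primary Q : Prop := is_ideal Q /\ prime_ideal (radical Q).

End Ideals.

Record QPrim (R : comPzRingType) := MkQPrim {
  qprim_set :> set R;
  qprim_quasi_primary : quasi_primary qprim_set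
}.

Definition Vq (R : comPzRingType) (I : set R) : set (QPrim R) :=
  [set Q : QPrim R | I `<=` radical Q].

Definition zariski_open (R : comPzRingType) : set_system (QPrim R) :=
  [set U | exists2 I : set R, is_ideal I & ~` U = Vq I].

Section ZariskiTopology.
Variable R : comPzRingType.
Implicit Types (I J : set R) (Q : QPrim R).

Let radical_prime Q : prime_ideal (radical Q).
Proof. by case: (qprim_quasi_primary Q). Qed.

Let radical_ideal Q : is_ideal (radical Q).
Proof. by case: (radical_prime Q). Qed.

Lemma zariski_openT : zariski_open [set: QPrim R].
Proof.
exists [set: R]; first by split.
rewrite setCT; apply/esym/seteqP; split=> // Q QT.
by have [_ Q1 _] := radical_prime Q; apply: Q1; apply: QT.
Qed.

Lemma zariski_openI : setI_closed (@zariski_open R).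
Proof.
move=> U V [I idI UI] [J idJ VJ]; exists (I `&` J).
  case: idI idJ => I0 ID IM [J0 JD JM]; split=> //.
  - by move=> x y [Ix Jx] [Iy Jy]; split; [apply: ID|apply: JD].
  - by move=> a x [Ix Jx]; split; [apply: IM|apply: JM].
rewrite setCI UI VJ; apply/seteqP; split=> Q /=.
  by case=> sQ x [Ix Jx]; apply: sQ.
move=> sQ; have [//|nIQ] := pselect (Vq I Q); first by left.
right=> y Jy; apply: contrapT => nQy; apply: nIQ => x Ix.
have [_ _ Qpr] := radical_prime Q.
case: idI idJ => _ _ IM [_ _ JM].
have /sQ/Qpr[//|//] : (I `&` J) (x * y).
by split; [rewrite mulrC; apply: IM|apply: JM].
Qed.

Lemma zariski_open_bigU (T : Type) (f : T -> set (QPrim R)) :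
  (forall i, zariski_open (f i)) -> zariski_open (\bigcup_i f i).
Proof.
move=> fop; have /choice[I If] : forall i, exists I : set R,
    is_ideal I /\ ~` f i = Vq I.
  by move=> i; have [I] := fop i; exists I.
pose S := [set x | forall J, is_ideal J -> (forall i, I i `<=` J) -> J x].
exists S.
  split.
  - by move=> J [].
  - by move=> x y Sx Sy J idJ IJ; case: (idJ) => _ JD _; apply: JD;
      [apply: Sx|apply: Sy].
  - by move=> a x Sx J idJ IJ; case: (idJ) => _ _ JM; apply: JM; apply: Sx.
rewrite setC_bigcup; apply/seteqP; split=> Q /=.
  move=> nfQ x Sx; apply: Sx; first exact: radical_ideal.
  move=> i; have [_ fI] := If i.
  by have := nfQ i Logic.I; rewrite fI.
move=> SQ i _; have [_ ->] := If i.
by move=> x Ix; apply: SQ => J _ IJ; exact: (IJ i).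
Qed.

HB.instance Definition _ := gen_eqMixin (QPrim R).
HB.instance Definition _ := gen_choiceMixin (QPrim R).
HB.instance Definition _ := isOpenTopological.Build (QPrim R)
  zariski_openT zariski_openI zariski_open_bigU.

Lemma closed_zariskiP (A : set (QPrim R)) :
  closed A <-> exists2 I : set R, is_ideal I & A = Vq I.
Proof.
have openE : @open (QPrim R) = @zariski_open R by [].
by rewrite -openC openE /zariski_open /= setCK.
Qed.

End ZariskiTopology.

Definition ring_isomorphic (R S : pzRingType) : Prop :=
  exists f : {rmorphism R -> S}, bijective f.

(* Main.v *)
From HB Require Import structures.
Require Import Defs.
From mathcomp Require Import all_boot all_algebra.
From mathcomp Require Import all_classical topology.
From mathcomp Require Import ring.
Local Open Scope classical_set_scope.
Local Open Scope ring_scope.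

Set Implicit Arguments.
Unset Strict Implicit.
Unset Printing Implicit Defensive.
Import GRing.Theory.

(** The subspace Spec R of QPrim R already controls everything: a prime is its
own radical, so every ideal I that omits all powers of x is contained in a point Q
of QPrim R whose radical omits x ([exists_qprim_avoiding], by Zorn's lemma). With
x = 1 this makes V_q(I) nonempty as soon as I is proper, and with I = 0 it makes
an element lying in all the radicals nilpotent.

Suppose that QPrim R is the disjoint union of two nonempty closed sets V_q(I)
and V_q(J). As they are disjoint, I + J is the unit ideal, say a + b = 1 with a in I
and b in J; as they cover the space, a b lies in every radical, so (a b)^n = 0
for some n. Powers of comaximal elements are comaximal, so 1 = u a^n + v b^n,
and e = u a^n is idempotent because e (1 - e) is a multiple of (a b)^n. Were e
equal to 1 or 0, then I or J would be the unit ideal and one of the pieces would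
be empty ([idempotent_of_disconnected]).

Conversely, if e is a nontrivial idempotent, then e (1 - e) = 0 forces every
prime to contain exactly one of e and 1 - e, so the nonempty sets V_q(Re) and
V_q(R(1 - e)) are complementary ([disconnected_of_idempotent]).

Finally, a nontrivial idempotent e splits R as eR x (1 - e)R, where each factor is a
nonzero ring with its own identity ([product_of_idempotent]); in the other
direction (1, 0) is a nontrivial idempotent of a product of nonzero rings. *)

(** * Sums of ideals and principal ideals *)

Section IdealSum.
Variable R : comPzRingType.
Implicit Types I J : set R.

Definition ideal_sum I J : set R :=
  [set z | exists x y, [/\ I x, J y & z = x + y]].

Definition principal (x : R) : set R := [set z | exists r, z = r * x].

Lemma ideal_sum_ideal I J : is_ideal I -> is_ideal J -> is_ideal (ideal_sum I J).
Proof.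
move=> [I0 ID IM] [J0 JD JM]; split.
- by exists 0, 0; rewrite addr0.
- move=> _ _ [a [b [Ia Jb ->]]] [a' [b' [Ia' Jb' ->]]].
  by exists (a + a'), (b + b'); split; [exact: ID | exact: JD | rewrite addrACA].
- move=> r _ [a [b [Ia Jb ->]]].
  by exists (r * a), (r * b); split; [exact: IM | exact: JM | rewrite mulrDr].
Qed.

Lemma sub_ideal_suml I J : is_ideal J -> I `<=` ideal_sum I J.
Proof. by move=> [J0 _ _] x Ix; exists x, 0; rewrite addr0. Qed.

Lemma sub_ideal_sumr I J : is_ideal I -> J `<=` ideal_sum I J.
Proof. by move=> [I0 _ _] x Jx; exists 0, x; rewrite add0r. Qed.

Lemma principal_ideal x : is_ideal (principal x).
Proof.
split; first by exists 0; rewrite mul0r.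
- by move=> _ _ [r ->] [s ->]; exists (r + s); rewrite mulrDl.
- by move=> a _ [r ->]; exists (a * r); rewrite mulrA.
Qed.

Lemma mem_principal x : principal x x.
Proof. by exists 1; rewrite mul1r. Qed.

Lemma zero_ideal : is_ideal [set (0 : R)].
Proof.
split=> //= [x y -> ->|a x ->]; first by rewrite addr0.
by rewrite mulr0.
Qed.

End IdealSum.

(** * Prime ideals avoiding the powers of an element *)

Section PrimeAvoiding.
Variable R : comPzRingType.
Implicit Types (I P : set R) (x : R).

(** Zorn's lemma: the avoidance of the powers of x passes to unions of chains,
since a power of x in the union already lies in one member. *)
Lemma exists_maximal_avoiding I x : is_ideal I -> ~ radical I x ->
  exists P, [/\ is_ideal P, I `<=` P, ~ radical P x &
    forall J, is_ideal J -> P `<` J -> radical J x].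
Proof.
move=> idI nIx.
pose good (P : set R) := [/\ is_ideal P, I `<=` P & ~ radical P x].
have good_I : good I by split.
(* The union of the empty chain is the empty set, which is not an ideal; it is
   therefore admitted as an extra element below all the others. *)
have [F Fgood Ftot|A [goodA maxA]] :=
    @Zorn_bigcup R (fun P => P = set0 \/ good P).
  have [[X0 [FX0 gX0]]|noX] := pselect (exists X, F X /\ good X); last first.
    left; apply/seteqP; split=> // y [X FX Xy].
    have [X0|gX] := Fgood X FX; first by rewrite X0 in Xy.
    by case: noX; exists X.
  have memgood X y : F X -> X y -> good X.
    by move=> FX Xy; have [X_0|//] := Fgood X FX; rewrite X_0 in Xy.
  right; split; last first.
  - move=> [n [X FX Xxn]]; have [_ _] := memgood _ _ FX Xxn.
    by apply; exists n.
  - move=> y Iy; exists X0 => //.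
    by have [_ + _] := gX0; apply.
  - split.
    + by exists X0 => //; have [[]] := gX0.
    + move=> y z [X FX Xy] [Y FY Yz].
      have [[_ XD _] _ _] := memgood _ _ FX Xy.
      have [[_ YD _] _ _] := memgood _ _ FY Yz.
      have [XY|YX] := Ftot X Y FX FY.
        by exists Y => //; apply: YD => //; exact: XY.
      by exists X => //; apply: XD => //; exact: YX.
    + move=> a y [X FX Xy]; exists X => //.
      by have [[_ _ XM] _ _] := memgood _ _ FX Xy; exact: XM.
(* The maximal element is not the added one, because I lies strictly above it. *)
have {}goodA : good A.
  case: goodA => // A0; exfalso; apply: (maxA I); last by right.
  rewrite A0; split=> // /(_ 0); apply.
  by have [] := idI.
have [idA IA nAx] := goodA; exists A; split=> // J idJ AJ.
apply: contrapT => nJx; apply: (maxA J AJ); right; split=> //.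
by apply: subset_trans IA _; exact: properW AJ.
Qed.

(** An ideal P maximal among those avoiding the powers of x is prime: if y and z
are outside P, then P + Ry and P + Rz contain powers of x, whose product lies in
P + Ryz; so yz cannot be in P. *)
Lemma exists_prime_avoiding I x : is_ideal I -> ~ radical I x ->
  exists P, [/\ prime_ideal P, I `<=` P & ~ P x].
Proof.
move=> idI nIx.
have [P [idP IP nPx maxP]] := exists_maximal_avoiding idI nIx.
have [P0 PD PM] := idP.
exists P; split=> //; last by move=> Px; apply: nPx; exists 0%N.
split=> //.
  by move=> P1; apply: nPx; exists 0%N; rewrite -[x ^+ 1]mulr1; exact: PM.
have rad_adjoin y : ~ P y -> radical (ideal_sum P (principal y)) x.
  move=> nPy; apply: maxP.
    exact: ideal_sum_ideal idP (principal_ideal y).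
  split; first exact: sub_ideal_suml (principal_ideal y).
  by move=> sP; apply/nPy/sP/(sub_ideal_sumr idP)/mem_principal.
move=> y z Pyz; apply: contrapT => /not_orP[nPy nPz]; apply: nPx.
have [m [a [_ [Pa [r ->] xm]]]] := rad_adjoin y nPy.
have [n [b [_ [Pb [s ->] xn]]]] := rad_adjoin z nPz.
exists (m + n.+1)%N; rewrite -addSn exprD xm xn.
have -> : (a + r * y) * (b + s * z) =
    (b + s * z) * a + (r * y) * b + (r * s) * (y * z) by ring.
by apply: (PD); [apply: PD|]; exact: PM.
Qed.

Lemma radical_of_prime P : prime_ideal P -> radical P = P.
Proof.
move=> [_ P1 Pmul]; apply/seteqP; split=> x; last by exists 0%N.
move=> [n]; elim: n => [//|n IHn]; rewrite exprS.
by move=> /Pmul[].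
Qed.

Lemma prime_quasi_primary P : prime_ideal P -> quasi_primary P.
Proof. by move=> Ppr; split; [case: Ppr | rewrite radical_of_prime]. Qed.

(** A prime is a point of QPrim R whose radical is itself. Both the nonemptiness of V_q and the
nilpotence criterion below are special cases of this. *)
Lemma exists_qprim_avoiding I x : is_ideal I -> ~ radical I x ->
  exists2 Q : QPrim R, Vq I Q & ~ radical Q x.
Proof.
move=> idI /(exists_prime_avoiding idI)[P [Ppr IP nPx]].
exists (MkQPrim (prime_quasi_primary Ppr)); last by rewrite /= radical_of_prime.
by rewrite /Vq /= radical_of_prime.
Qed.

(** The case x = 1, where avoiding the powers of x means being proper. *)
Lemma nonempty_Vq I : is_ideal I -> ~ I 1 -> Vq I !=set0.
Proof.
move=> idI nI1; have nrad : ~ radical I 1 by case=> n; rewrite expr1n.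
by have [Q IQ _] := exists_qprim_avoiding idI nrad; exists Q.
Qed.

(** The case I = 0, where avoiding the powers of x means that x is not
nilpotent. *)
Lemma nilpotent_of_radicals x :
  (forall Q : QPrim R, radical Q x) -> exists n : nat, x ^+ n = 0.
Proof.
move=> radx; apply: contrapT => nilx.
have nrad : ~ radical [set (0 : R)] x.
  by move=> [n xn]; apply: nilx; exists n.+1.
by have [Q _] := exists_qprim_avoiding (@zero_ideal R) nrad; apply.
Qed.

Lemma Vq_unit_ideal I : I 1 -> Vq I = set0.
Proof.
move=> I1; apply/seteqP; split=> // Q IQ.
by have [_ [_ + _]] := qprim_quasi_primary Q; apply; exact: IQ.
Qed.

End PrimeAvoiding.

(** * Disconnections and idempotents *)

Section Idempotents.
Variable R : comPzRingType.

(** One exponent is raised at a time, and by one unit at a time: if 1 = u c + v d^k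
and 1 = s c + t d, the product of the two relations expresses 1 through c and
d^(k+1). *)
Lemma comaximal_powers (a b : R) m n : a + b = 1 ->
  exists u v, u * a ^+ m + v * b ^+ n = 1.
Proof.
have pow_right (c d : R) k : (exists u v, u * c + v * d = 1) ->
    exists u v, u * c + v * d ^+ k = 1.
  move=> [s [t st]]; elim: k => [|k [u [v uv]]].
    by exists 0, 1; rewrite mul0r add0r expr0 mulr1.
  exists (u * (s * c + t * d) + v * d ^+ k * s), (v * t).
  transitivity ((u * c + v * d ^+ k) * (s * c + t * d)); first by rewrite exprS; ring.
  by rewrite uv st mulr1.
move=> ab1; have [|u [v uv]] := pow_right a b n; first by exists 1, 1; rewrite !mul1r.
have [|s [t st]] := pow_right (b ^+ n) a m; first by exists v, u; rewrite addrC.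
by exists t, s; rewrite addrC.
Qed.

(** Lifting of idempotents modulo a nilpotent: a (1 - a) = a b is nilpotent, and
the relation 1 = u a^n + v b^n splits 1 into two summands whose product is a
multiple of (a b)^n = 0. The complement 1 - e is given as a multiple of b^n to
show that it stays in any ideal containing b. *)
Lemma idempotent_of_nilpotent_mul (a b : R) n : a + b = 1 -> (a * b) ^+ n = 0 ->
  exists u v, let e := u * a ^+ n in e * e = e /\ 1 - e = v * b ^+ n.
Proof.
move=> /(comaximal_powers n n)[u [v uv]] abn; exists u, v => /=.
split; last by rewrite -uv addrC addKr.
rewrite -[in RHS](mulr1 (u * a ^+ n)) -uv mulrDr.
rewrite (_ : u * a ^+ n * (v * b ^+ n) = u * v * (a * b) ^+ n).
  by rewrite abn mulr0 addr0.
by rewrite exprMn; ring.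
Qed.

Lemma ideal_exprS (I : set R) (a c : R) n : is_ideal I -> I a -> I (c * a ^+ n.+1).
Proof. by move=> [_ _ IM] Ia; rewrite exprSr mulrA; exact: IM. Qed.

Lemma idempotent_of_disconnected : ~ connected [set: QPrim R] ->
  exists e : R, [/\ e * e = e, e <> 0 & e <> 1].
Proof.
move=> disc; apply: contrapT => noidem; apply: disc => B B0 [C openC BC] [D closedD BD].
have [J idJ CJ] : exists2 J : set R, is_ideal J & ~` B = Vq J.
  by apply/closed_zariskiP/open_closedC; rewrite BC setTI.
have [I idI BI] : exists2 I : set R, is_ideal I & B = Vq I.
  by apply/closed_zariskiP; rewrite BD setTI.
(* A point of V_q(I + J) would lie both in B and in its complement. *)
have [a [b [Ia Jb ab1]]] : ideal_sum I J 1.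
  apply: contrapT => /(nonempty_Vq (ideal_sum_ideal idI idJ))[Q IJQ].
  have QB : B Q by rewrite BI; apply: subset_trans IJQ; exact: sub_ideal_suml.
  have : (~` B) Q by rewrite CJ; apply: subset_trans IJQ; exact: sub_ideal_sumr.
  exact.
(* Every point lies in V_q(I), where a is in the radical, or in V_q(J), where b is. *)
have [n abn] : exists n, (a * b) ^+ n = 0.
  apply: nilpotent_of_radicals => Q.
  have [_ [[_ _ QM] _ _]] := qprim_quasi_primary Q.
  have [BQ|nBQ] := pselect (B Q).
    by rewrite mulrC; apply: QM; move: BQ; rewrite BI; apply.
  by apply: QM; have : (~` B) Q by []; rewrite CJ; apply.
(* The exponent n.+1 rather than n guarantees at least one factor a in e and one
   factor b in 1 - e, hence e in I and 1 - e in J. *)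
have [|u [v [ee e1]]] :=
    @idempotent_of_nilpotent_mul a b n.+1 (esym ab1).
  by rewrite exprS abn mulr0.
set e := u * a ^+ n.+1 in ee e1.
have [e0|e_neq0] := pselect (e = 0).
  rewrite -[B]setCK CJ Vq_unit_ideal ?setC0//.
  by rewrite -(subr0 1) -e0 e1; exact: ideal_exprS.
have [e_eq1|e_neq1] := pselect (e = 1).
  case: B0 => Q; rewrite BI Vq_unit_ideal//.
  by rewrite -e_eq1; exact: ideal_exprS.
by case: noidem; exists e.
Qed.

Lemma compl_idempotent (e : R) : e * e = e -> (1 - e) * (1 - e) = 1 - e.
Proof. by move=> ee; rewrite mulrBr mulr1 mulrBl mul1r ee subrr subr0. Qed.

Lemma idempotent_mul_compl (e : R) : e * e = e -> e * (1 - e) = 0.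
Proof. by move=> ee; rewrite mulrBr mulr1 ee subrr. Qed.

Lemma idempotent_proper (e : R) : e * e = e -> e <> 1 -> ~ principal e 1.
Proof.
move=> ee e1 [r er]; apply: e1.
by rewrite -[LHS]mul1r er -mulrA ee.
Qed.

(** The radical of a quasi-primary ideal is prime, so it contains e or 1 - e, whose
product is 0; it cannot contain both, since their sum is 1. *)
Lemma Vq_principal_compl (e : R) : e * e = e ->
  ~` Vq (principal e) = Vq (principal (1 - e)).
Proof.
move=> ee; apply/seteqP; split=> Q;
    have [_ [[Q0 QD QM] Q1 Qpr]] := qprim_quasi_primary Q.
  move=> nQe _ [r ->]; apply: (QM).
  have [||//] := Qpr e (1 - e); first by rewrite idempotent_mul_compl.
  by move=> Qe; case: nQe => _ [s ->]; exact: QM.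
move=> Qf Qe; apply: Q1; rewrite -[1](subrK e); apply: QD.
  exact/Qf/mem_principal.
exact/Qe/mem_principal.
Qed.

Lemma disconnected_of_idempotent (e : R) : e * e = e -> e <> 0 -> e <> 1 ->
  ~ connected [set: QPrim R].
Proof.
move=> ee e0 e1 conn.
have ff := compl_idempotent ee.
have f1 : 1 - e <> 1.
  by move=> /(congr1 (fun x => 1 - x)); rewrite subKr subrr.
have /(nonempty_Vq (principal_ideal (1 - e)))[Q] := idempotent_proper ff f1.
rewrite -(Vq_principal_compl ee); apply.
rewrite (conn (Vq (principal e))) //.
- exact: nonempty_Vq (principal_ideal e) (idempotent_proper ee e1).
- exists (Vq (principal e)); last by rewrite setTI.
  by exists (principal (1 - e)); [exact: principal_ideal | exact: Vq_principal_compl].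
- exists (Vq (principal e)); last by rewrite setTI.
  by apply/closed_zariskiP; exists (principal e) => //; exact: principal_ideal.
Qed.

End Idempotents.

(** * The corner ring of an idempotent *)

Section Corner.
Variables (R : comPzRingType) (e : R).

Definition corner_pred : {pred R} := [pred x | e * x == x].

Fact corner_zmod_closed : zmod_closed corner_pred.
Proof.
split=> [|x y]; rewrite !inE ?mulr0// => /eqP ex /eqP ey.
by rewrite mulrBr ex ey.
Qed.
HB.instance Definition _ := GRing.isZmodClosed.Build R corner_pred corner_zmod_closed.

(** The ring eR, carried by the elements fixed by multiplication by e. Its identity is e,
so it is a subgroup but not a subring of R, and its multiplicative structure has to be
built anew. The proofs that e is idempotent and nonzero are parameters of the
type because the ring structure on it depends on them. *)
Record corner (ee : e * e = e) (e0 : e <> 0) :=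
  Corner { corner_val : R; cornerP : corner_val \in corner_pred }.

Hypotheses (ee : e * e = e) (e0 : e <> 0).
Local Notation C := (corner ee e0).

HB.instance Definition _ := [isSub for @corner_val ee e0].
HB.instance Definition _ := [Choice of C by <:].
HB.instance Definition _ := [SubChoice_isSubZmodule of C by <:].

Lemma mul_corner_val (x : C) : e * val x = val x.
Proof. exact/eqP/(valP x). Qed.

Lemma val_cornerD (x y : C) : val (x + y) = val x + val y.
Proof. exact: raddfD. Qed.

Fact in_corner (x : R) : e * x \in corner_pred.
Proof. by rewrite inE mulrA ee. Qed.

Definition to_corner (x : R) : C := Corner ee e0 (in_corner x).

(* Products are passed through [to_corner] to get membership in eR for free;
   by [val_corner_mul] this does not change their value. *)
Definition corner_one : C := to_corner 1.
Definition corner_mul (x y : C) : C := to_corner (val x * val y).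

Lemma val_corner_one : val corner_one = e. Proof. exact: mulr1. Qed.

Lemma val_corner_mul x y : val (corner_mul x y) = val x * val y.
Proof. by rewrite /= mulrA mul_corner_val. Qed.

Fact corner_mulA : associative corner_mul.
Proof. by move=> x y z; apply: val_inj; rewrite !val_corner_mul mulrA. Qed.
Fact corner_mulC : commutative corner_mul.
Proof. by move=> x y; apply: val_inj; rewrite !val_corner_mul mulrC. Qed.
Fact corner_mul1 : left_id corner_one corner_mul.
Proof. move=> x; apply: val_inj.
by rewrite val_corner_mul val_corner_one mul_corner_val. Qed.
Fact corner_mulDl : left_distributive corner_mul +%R.
Proof.
move=> x y z; apply: val_inj.
by rewrite val_corner_mul !val_cornerD mulrDl !val_corner_mul.
Qed.
Fact corner_one_neq0 : corner_one != 0.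
Proof. by apply/eqP => /(congr1 val); rewrite val_corner_one raddf0. Qed.
HB.instance Definition _ := GRing.Zmodule_isComNzRing.Build C
  corner_mulA corner_mulC corner_mul1 corner_mulDl corner_one_neq0.

Fact to_corner_zmod_morphism : zmod_morphism to_corner.
Proof. by move=> x y; apply: val_inj; rewrite raddfB /= mulrBr. Qed.
HB.instance Definition _ := GRing.isZmodMorphism.Build R C to_corner
  to_corner_zmod_morphism.
Fact to_corner_monoid_morphism : monoid_morphism to_corner.
Proof.
split=> // x y; apply: val_inj; rewrite val_corner_mul /=.
by rewrite mulrACA ee.
Qed.
HB.instance Definition _ := GRing.isMonoidMorphism.Build R C to_corner
  to_corner_monoid_morphism.

End Corner.

(** * Product decompositions *)

Section Peirce.
Variables (R : comPzRingType) (e : R).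
Hypotheses (ee : e * e = e) (e0 : e <> 0).
(* The facts about 1 - e follow from those about e; they are taken as variables
   so that the type of [to_corners] does not mention any particular proof. *)
Hypotheses (ff : (1 - e) * (1 - e) = 1 - e) (f0 : 1 - e <> 0).

Definition to_corners (x : R) : corner ee e0 * corner ff f0 :=
  (to_corner ee e0 x, to_corner ff f0 x).

Fact to_corners_zmod_morphism : zmod_morphism to_corners.
Proof. by move=> x y; rewrite /to_corners !raddfB. Qed.
HB.instance Definition _ := GRing.isZmodMorphism.Build R _ to_corners
  to_corners_zmod_morphism.
Fact to_corners_monoid_morphism : monoid_morphism to_corners.
Proof. by split=> [|x y]; rewrite /to_corners ?rmorph1 ?rmorphM. Qed.
HB.instance Definition _ := GRing.isMonoidMorphism.Build R _ to_corners
  to_corners_monoid_morphism.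

(** The inverse is addition in R: x = e x + (1 - e) x, and each idempotent
annihilates the corner of the other. *)
Lemma to_corners_bij : bijective to_corners.
Proof.
exists (fun p => val p.1 + val p.2) => [x|[x y]] /=.
  by rewrite -mulrDl subrKC mul1r.
have fx : (1 - e) * val x = 0.
  by rewrite -(mul_corner_val x) mulrA (mulrC _ e) idempotent_mul_compl// mul0r.
have ey : e * val y = 0.
  by rewrite -(mul_corner_val y) mulrA idempotent_mul_compl// mul0r.
congr pair; apply: val_inj; rewrite /= mulrDr.
  by rewrite ey addr0 mul_corner_val.
by rewrite fx add0r mul_corner_val.
Qed.

End Peirce.

Lemma idempotent_of_product (R : comPzRingType) (R1 R2 : comNzRingType) :
  ring_isomorphic R (R1 * R2)%type -> exists e : R, [/\ e * e = e, e <> 0 & e <> 1].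
Proof.
move=> [f [g fK gK]]; have f_inj := can_inj fK.
have fg : f (g (1, 0)) = (1, 0) by exact: gK.
exists (g (1, 0)); split.
- by apply: f_inj; rewrite rmorphM fg; congr pair; rewrite ?mulr1 ?mulr0.
- by move=> /(congr1 f); rewrite fg rmorph0 => -[/eqP]; rewrite oner_eq0.
- move=> /(congr1 f); rewrite fg rmorph1 => -[/esym/eqP].
  by rewrite oner_eq0.
Qed.

Lemma product_of_idempotent (R : comPzRingType) (e : R) :
  e * e = e -> e <> 0 -> e <> 1 ->
  exists R1 R2 : comNzRingType, ring_isomorphic R (R1 * R2)%type.
Proof.
move=> ee e0 e1; have ff := compl_idempotent ee.
have f0 : 1 - e <> 0 by move=> /subr0_eq/esym.
exists (corner ee e0), (corner ff f0).
by exists (to_corners ee e0 ff f0); exact: to_corners_bij.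
Qed.

Theorem theorem2p14 (R : comPzRingType) :
  [<-> ~ connected [set: QPrim R];
       exists R1 R2 : comNzRingType, ring_isomorphic R (R1 * R2)%type;
       exists e : R, [/\ e * e = e, e <> 0 & e <> 1]].
Proof.
tfae.
- move=> /idempotent_of_disconnected[e [ee e0 e1]].
  exact: product_of_idempotent ee e0 e1.
- by move=> [R1 [R2]]; exact: idempotent_of_product.
- move=> [e [ee e0 e1]]; exact: disconnected_of_idempotent ee e0 e1.
Qed.
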